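(* Let $n$ be a natural number and $\mathfrak{B}\in\mathbb{B}^n$ an atomic base. Suppose that for all finite sets of formulas $\Gamma$, all formulas $A$ and all $\mathfrak{C}\supseteq_n\mathfrak{B}$, $\Gamma\models^s_{\mathfrak{C},n}A$ implies $\Gamma\models^\alpha_{\mathfrak{C},n}A$. Then for all finite sets of formulas $\Gamma$, all formulas $A$ and all $\mathfrak{C}\supseteq_n\mathfrak{B}$, $\Gamma\models^\alpha_{\mathfrak{C},n}A$ implies $\Gamma\models^s_{\mathfrak{C},n}A$.
   Context: LANGUAGE. $\mathscr{L}$ is the propositional language whose formulas are built from infinitely many propositional letters and the atomic constant $\bot$ by $\wedge,\vee,\rightarrow$; $\neg X := X \rightarrow \bot$. $\mathrm{ATOM}$ is the set of the letters together with $\bot$. $\Gamma,\Delta$ always range over finite sets of formulas. ATOMIC RULES. A rule of level $0$ is an atom (an axiom). A rule of level $1$ infers an atom $A$ from atoms $A_1,\dots,A_m$. For $k\ge 1$, if $\Re_1,\dots,\Re_m$ are finite sets of atomic rules (some possibly empty) of maximal level $k-1$, then $([\Re_1]A_1,\dots,[\Re_m]A_m)/A$, which infers the atom $A$ from the atoms $A_1,\dots,A_m$ and discharges the rules in $\Re_i$ in the derivation of the $i$-th premise, is a rule of level $k+1$. ATOMIC BASES. An atomic base is a (possibly infinite) set $\mathfrak{B}$ of atomic rules containing the explosion rule $\bot/A$ for every atom $A$; its level is the maximal level of its rules other than the explosion rules ($0$ if there are none). $\mathbb{B}^n$ is the set of bases of level $\le n$. $\mathfrak{C}\supseteq_n\mathfrak{B}$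 means $\mathfrak{C}\supseteq\mathfrak{B}$ and $\mathfrak{C}\in\mathbb{B}^n$. Derivations in $\mathfrak{B}$ are defined inductively: an atom $A$ is a single-node derivation of $A$, from no assumed rules if the axiom $A\in\mathfrak{B}$ is applied, and from the assumed rule $A$ if $A$ is assumed; if $\mathscr{D}_i$ derives $A_i$ from assumed rules $\mathfrak{C}_i\cup\Re_i$ ($i\le m$), then applying $R=([\Re_1]A_1,\dots,[\Re_m]A_m)/A$ yields a derivation of $A$ from $\bigcup_i\mathfrak{C}_i$ if $R\in\mathfrak{B}$, and from $\bigcup_i\mathfrak{C}_i\cup\{R\}$ if $R\notin\mathfrak{B}$. $\vdash_{\mathfrak{B}}A$ means that there is a derivation of $A$ in $\mathfrak{B}$ from no assumed rules (a closed derivation). SANDQVIST'S BASE SEMANTICS. For $\mathfrak{B}\in\mathbb{B}^n$, define: for $A\in\mathrm{ATOM}$, $\models^s_{\mathfrak{B},n}A$ iff $\vdash_{\mathfrak{B}}A$; $\models^s_{\mathfrak{B},n}B\wedge C$ iff $\models^s_{\mathfrak{B},n}B$ and $\models^s_{\mathfrak{B},n}C$; $\models^s_{\mathfrak{B},n}B\vee C$ iff for all $\mathfrak{C}\supseteq_n\mathfrak{B}$ and all $D\in\mathrm{ATOM}$, if $B\models^s_{\mathfrak{C},n}D$ and $C\models^s_{\mathfrak{C},n}D$ then $\models^s_{\mathfrak{C},n}D$; $\models^s_{\mathfrak{B},n}B\rightarrow C$ iff $B\models^s_{\mathfrak{B},n}C$; for $\Gamma\ne\emptyset$, $\Gamma\models^s_{\mathfrak{B},n}A$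 iff for all $\mathfrak{C}\supseteq_n\mathfrak{B}$, if $\models^s_{\mathfrak{C},n}B$ for all $B\in\Gamma$ then $\models^s_{\mathfrak{C},n}A$. REDUCIBILITY SEMANTICS. An argument structure $\mathscr{D}=\langle T,\langle f,h,g\rangle\rangle$ consists of a finite rooted tree $T$ with nodes labelled by formulas ($\mu\prec\nu$ means that $\nu$ lies below $\mu$, towards the root), whose leaves are partitioned into assumption leaves $\mathrm{as}(T)$ and axiom leaves $\mathrm{ax}(T)$, and of partial discharge functions: $f$ is defined on a subset of $\mathrm{as}(T)$ with $\mu\prec f(\mu)$; $h$ is defined on a subset of $\mathrm{ax}(T)$ with $\mu\prec h(\mu)$, where $h(\mu)$ and its children are labelled by atoms and $h(\mu)$ is not a value of $f$; $g$ is defined on a set of sets $K$ of edges, each $K$ consisting of all and only the edges linking a node $\mu_K$ to its children, where $\mu_K$ and its children are labelled by atoms, $\mu_K$ is not a value of $f$, $\mu_K\prec g(K)$, $g(K)$ and its children are labelled by atoms, and $g(K)$ is not a value of $f$. ($f$ discharges assumptions; $h$ and $g$ discharge assumed atomic rules of level $0$ and higher.) The root label is the conclusion. $\mathscr{D}$ is from $\Gamma$ to $A$ if $\Gamma$ is the set of its undischarged assumptions and $A$ its conclusion; it is closed if $\Gamma=\emptyset$, open otherwise. Derivations in $\mathfrak{B}$ are regarded as argument structures with all labels atomic and $f$ empty. $\mathscr{D}[\mathscr{D}^{**}/\mathscr{D}^*]$ is the result of replacing the sub-structure $\mathscr{D}^*$ by $\mathscr{D}^{**}$ in $\mathscr{D}$,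 the discharge functions being redefined in the natural way (discharges of surviving or copied assumptions and assumed rules take place at the corresponding nodes; the others disappear). If $\mathscr{D}$ is from $\Gamma=\{\mu_1,\dots,\mu_m\}$ and $\sigma$ assigns to each $\mu_i$ an argument structure $\sigma(\mu_i)$ with the same conclusion as $\mu_i$, then $\mathscr{D}^\sigma=\mathscr{D}[\sigma(\mu_1),\dots,\sigma(\mu_m)/\mu_1,\dots,\mu_m]$; it is a closed $\sigma$-instance if all $\sigma(\mu_i)$ are closed. An inference is a triple $\langle\langle\mathscr{D}_1,\dots,\mathscr{D}_m\rangle,A,\delta\rangle$ with $\delta$ an extension of the discharge functions of the $\mathscr{D}_i$; its associated argument structure joins the trees of the $\mathscr{D}_i$ by a new root $A$ and adds the discharges $\delta$. A rule is a (recursive) set of inferences, its instances. Introduction rules are Gentzen's: $A,B/A\wedge B$; $A_i/A_1\vee A_2$ ($i=1,2$); $[A]B/A\rightarrow B$. $\mathscr{D}$ is canonical if it is associated to an instance of an introduction rule. A reduction for a rule $R$ is a map $\phi$ from and to argument structures, defined on some set $\mathbb{D}$ of argument structures associated to instances of $R$, such that for all $\mathscr{D}\in\mathbb{D}$: (a) if $\mathscr{D}$ is from $\Gamma$ to $A$, then $\phi(\mathscr{D})$ is from some $\Gamma^*\subseteq\Gamma$ to $A$; (b) for all $\sigma$, $\phi$ is defined on $\mathscr{D}^\sigma$ and $\phi(\mathscr{D}^\sigma)=\phi(\mathscr{D})^\sigma$. For a set $\mathfrak{J}$ of reductions, $\mathscr{D}\leq_{\mathfrak{J}}\mathscr{D}^*$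 is the reflexive-transitive closure of: $\mathscr{D}^*=\mathscr{D}[\phi(\mathscr{D}^{**})/\mathscr{D}^{**}]$ for some sub-structure $\mathscr{D}^{**}$ of $\mathscr{D}$ and some $\phi\in\mathfrak{J}$. An argument is a pair $\langle\mathscr{D},\mathfrak{J}\rangle$. It is $n$-valid on $\mathfrak{B}\in\mathbb{B}^n$ iff: when $\mathscr{D}$ is closed with atomic conclusion, $\mathscr{D}\leq_{\mathfrak{J}}\mathscr{D}^*$ for some closed derivation $\mathscr{D}^*$ in $\mathfrak{B}$; when $\mathscr{D}$ is closed with non-atomic conclusion, $\mathscr{D}\leq_{\mathfrak{J}}\mathscr{D}^*$ for some canonical $\mathscr{D}^*$ whose immediate sub-structures, paired with $\mathfrak{J}$, are $n$-valid on $\mathfrak{B}$; when $\mathscr{D}$ is open with undischarged assumptions $\Gamma$, for all $\sigma$ assigning closed structures, all sets of reductions $\mathfrak{J}^+\supseteq\mathfrak{J}$ and all $\mathfrak{C}\supseteq_n\mathfrak{B}$, if $\langle\sigma(\mu),\mathfrak{J}^+\rangle$ is $n$-valid on $\mathfrak{C}$ for all $\mu\in\Gamma$, then $\langle\mathscr{D}^\sigma,\mathfrak{J}^+\rangle$ is $n$-valid on $\mathfrak{C}$. $\Gamma\models^\alpha_{\mathfrak{B},n}A$ means that some argument $\langle\mathscr{D},\mathfrak{J}\rangle$ with $\mathscr{D}$ from $\Gamma$ to $A$ is $n$-valid on $\mathfrak{B}$. *)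

(* Defs.v *)
(* MathComp, with finmap for finite sets of formulas. *)
From HB Require Import structures.
From Stdlib Require List Relation_Operators.
From mathcomp Require Import all_boot finmap.

Set Implicit Arguments.
Unset Strict Implicit.
Unset Printing Implicit Defensive.

Local Open Scope fset_scope.
Local Open Scope nat_scope.

(** * Language *)

Inductive atom := Bot | Letter of nat.

Inductive form :=
  | Atm of atom
  | And of form & form
  | Or of form & form
  | Imp of form & form.

Definition is_atom (A : form) : bool := if A is Atm _ then true else false.

Fixpoint form_to_tree (A : form) : GenTree.tree nat :=
  match A with
  | Atm Bot => GenTree.Leaf 0
  | Atm (Letter p) => GenTree.Leaf p.+1
  | And X Y => GenTree.Node 0 [:: form_to_tree X; form_to_tree Y]
  | Or X Y => GenTree.Node 1 [:: form_to_tree X; form_to_tree Y]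
  | Imp X Y => GenTree.Node 2 [:: form_to_tree X; form_to_tree Y]
  end.

Fixpoint form_of_tree (t : GenTree.tree nat) : form :=
  match t with
  | GenTree.Leaf p.+1 => Atm (Letter p)
  | GenTree.Node 0 [:: x; y] => And (form_of_tree x) (form_of_tree y)
  | GenTree.Node 1 [:: x; y] => Or (form_of_tree x) (form_of_tree y)
  | GenTree.Node 2 [:: x; y] => Imp (form_of_tree x) (form_of_tree y)
  | _ => Atm Bot
  end.

Lemma form_to_treeK : cancel form_to_tree form_of_tree.
Proof. by elim=> [[|p]|X IHX Y IHY|X IHX Y IHY|X IHX Y IHY] //=; rewrite IHX IHY. Qed.

HB.instance Definition _ := Countable.copy form (can_type form_to_treeK).

(** * Atomic rules and atomic bases *)

(* [ARule [:: (R1, A1); ..; (Rm, Am)] A] is ([R1]A1, .., [Rm]Am) / A;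
   [ARule [::] A] is the axiom A. *)
Inductive arule := ARule of seq (seq arule * atom) & atom.

Definition aconcl (r : arule) : atom := let: ARule _ a := r in a.

Fixpoint level (r : arule) : nat :=
  match r with
  | ARule [::] _ => 0
  | ARule ps _ =>
      (foldr (fun p m =>
         maxn (foldr (fun s k => maxn (level s).+1 k) 0 p.1) m) 0 ps).+1
  end.

(* The dischargeable rules of a premise form a finite set, listed here in some
   order and possibly with repetitions; [same_rule] identifies the listings. *)
Inductive same_rule : arule -> arule -> Prop :=
  | SameRule ps qs a :
      List.Forall2 (fun p q =>
        [/\ p.2 = q.2,
            forall r, List.In r p.1 -> exists2 s, List.In s q.1 & same_rule r s
          & forall s, List.In s q.1 -> exists2 r, List.In r p.1 & same_rule r s])
        ps qs ->
      same_rule (ARule ps a) (ARule qs a).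

Definition explosion (a : atom) : arule := ARule [:: ([::], Bot)] a.

Definition rules := arule -> Prop.

Definition atomic_base (B : rules) : Prop :=
  (forall a, B (explosion a)) /\
  (forall r s, same_rule r s -> B r -> B s).

Definition base_of_level (n : nat) (B : rules) : Prop :=
  atomic_base B /\
  forall r, B r -> (forall a, r <> explosion a) -> level r <= n.

Definition extends_base (n : nat) (B C : rules) : Prop :=
  (forall r, B r -> C r) /\ base_of_level n C.

(** * Argument structures *)

(* Discharge functions are stored at the discharged nodes: a node carrying
   [Some k] is mapped to the k-th node below it (0 is its immediate successor
   towards the root), a node carrying [None] is outside the domain.
   [As A j] is an assumption leaf, and j the value of f.
   [Nd A j [::]] is an axiom leaf, and j the value of h.
   [Nd A j ts] with [ts] nonempty is an inner node, and j the value of g at the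
   set of edges which link this node to its children. *)
Inductive tree :=
  | As of form & option nat
  | Nd of form & option nat & seq tree.

Definition lab (t : tree) : form :=
  match t with As A _ => A | Nd A _ _ => A end.

(* some assumption of t is mapped by f to the k-th node below the root of t *)
Fixpoint f_hits (k : nat) (t : tree) : bool :=
  match t with
  | As _ j => j == Some k
  | Nd _ _ ts => has (f_hits k.+1) ts
  end.

(* the same for h and g *)
Fixpoint hg_hits (k : nat) (t : tree) : bool :=
  match t with
  | As _ _ => false
  | Nd _ j ts => (j == Some k) || has (hg_hits k.+1) ts
  end.

Definition in_scope (d : nat) (j : option nat) : bool :=
  if j is Some k then k < d else true.

(* the node and its children are atomic, and the node is not a value of f *)
Definition atomic_node (A : form) (ts : seq tree) : bool :=
  [&& is_atom A, all (fun t => is_atom (lab t)) ts & ~~ has (f_hits 0) ts].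

Fixpoint wf (d : nat) (t : tree) : bool :=
  match t with
  | As _ j => in_scope d j
  | Nd A j ts =>
      [&& in_scope d j, (j != None) || has (hg_hits 0) ts ==> atomic_node A ts
        & all (wf d.+1) ts]
  end.

Definition structure (D : tree) : bool := wf 0 D.

(* The assumptions of t which are not discharged within t, each one with its
   discharge, if any, below t: [Some e] stands for the e-th node below the root
   of t. *)
Fixpoint outer_as (d : nat) (t : tree) : seq (form * option nat) :=
  match t with
  | As A None => [:: (A, None)]
  | As A (Some k) => if k < d then [::] else [:: (A, Some (k - d))]
  | Nd _ _ ts => flatten (map (outer_as d.+1) ts)
  end.

(* The rule applications (conclusion and premises) of t which are discharged
   below t. *)
Fixpoint outer_rules (d : nat) (t : tree) : seq (form * seq form * nat) :=
  match t with
  | As _ _ => [::]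
  | Nd A j ts =>
      (if j is Some k then
         if k < d then [::] else [:: ((A, map lab ts), k - d)]
       else [::]) ++ flatten (map (outer_rules d.+1) ts)
  end.

Definition undischarged (D : tree) : {fset form} :=
  [fset A in unzip1 (outer_as 0 D)].

Definition closed (D : tree) : bool := undischarged D == fset0.

Definition from_to (G : {fset form}) (A : form) (D : tree) : Prop :=
  [/\ structure D, undischarged D = G & lab D = A].

(* [cut 0 t] is the sub-structure given by a subtree t: discharges at nodes
   outside t are dropped. *)
Fixpoint cut (d : nat) (t : tree) : tree :=
  let c j := if in_scope d j then j else None in
  match t with
  | As A j => As A (c j)
  | Nd A j ts => Nd A (c j) (map (cut d.+1) ts)
  end.

Definition immediate (D : tree) : seq tree :=
  if D is Nd _ _ ts then map (cut 0) ts else [::].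

Fixpoint subst (sigma : form -> tree) (t : tree) : tree :=
  match t with
  | As A None => sigma A
  | As _ (Some _) => t
  | Nd A j ts => Nd A j (map (subst sigma) ts)
  end.

Definition assignment (sigma : form -> tree) (G : {fset form}) : Prop :=
  forall A, A \in G -> structure (sigma A) /\ lab (sigma A) = A.

Definition closed_assignment (sigma : form -> tree) (G : {fset form}) : Prop :=
  assignment sigma G /\ forall A, A \in G -> closed (sigma A).

(** * Derivations in a base *)

(* Rule r may be applied at a node with discharge value j. The context [ctx]
   lists, for the nodes below, the rules discharged along the branch; C is the
   set of assumed rules. *)
Definition available (B C : rules) (ctx : seq (seq arule)) (j : option nat)
    (r : arule) : Prop :=
  match j with
  | None => B r \/ C r
  | Some k => List.In r (nth [::] ctx k)
  end.

Inductive derivation (B C : rules) : seq (seq arule) -> tree -> Prop :=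
  | Derivation ctx ps a j ts :
      available B C ctx j (ARule ps a) ->
      premise_derivations B C ctx ps ts ->
      derivation B C ctx (Nd (Atm a) j ts)
with premise_derivations (B C : rules) :
    seq (seq arule) -> seq (seq arule * atom) -> seq tree -> Prop :=
  | PremisesNil ctx : premise_derivations B C ctx [::] [::]
  | PremisesCons ctx p ps t ts :
      lab t = Atm p.2 ->
      derivation B C (p.1 :: ctx) t ->
      premise_derivations B C ctx ps ts ->
      premise_derivations B C ctx (p :: ps) (t :: ts).

Definition closed_derivation (B : rules) (D : tree) : Prop :=
  derivation B (fun _ => False) [::] D.

Definition derivable (B : rules) (a : atom) : Prop :=
  exists2 D, closed_derivation B D & lab D = Atm a.

(** * Sandqvist's base semantics *)

Fixpoint s_valid (n : nat) (B : rules) (A : form) : Prop :=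
  match A with
  | Atm a => derivable B a
  | And X Y => s_valid n B X /\ s_valid n B Y
  | Or X Y =>
      forall C, extends_base n B C -> forall a : atom,
        (forall E, extends_base n C E -> s_valid n E X -> derivable E a) ->
        (forall E, extends_base n C E -> s_valid n E Y -> derivable E a) ->
        derivable C a
  | Imp X Y =>
      forall C, extends_base n B C -> s_valid n C X -> s_valid n C Y
  end.

Definition s_consequence (n : nat) (B : rules) (G : {fset form}) (A : form) :
    Prop :=
  if G == fset0 then s_valid n B A
  else forall C, extends_base n B C ->
         (forall X, X \in G -> s_valid n C X) -> s_valid n C A.

(** * Inferences and introduction rules *)

(* Partial recursive functions: [recf_eval f xs y] means f(xs) = y. *)
Inductive recf :=
  | RZero | RSucc | RProj of nat | RComp of recf & seq recf
  | RRec of recf & recf | RMu of recf.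

Inductive recf_eval : recf -> seq nat -> nat -> Prop :=
  | EZero xs : recf_eval RZero xs 0
  | ESucc x xs : recf_eval RSucc (x :: xs) x.+1
  | EProj i xs : i < size xs -> recf_eval (RProj i) xs (nth 0 xs i)
  | EComp f gs xs ys y :
      List.Forall2 (fun g z => recf_eval g xs z) gs ys ->
      recf_eval f ys y -> recf_eval (RComp f gs) xs y
  | ERec0 f g xs y : recf_eval f xs y -> recf_eval (RRec f g) (0 :: xs) y
  | ERecS f g m xs z y :
      recf_eval (RRec f g) (m :: xs) z -> recf_eval g (m :: z :: xs) y ->
      recf_eval (RRec f g) (m.+1 :: xs) y
  | EMu f xs m :
      recf_eval f (m :: xs) 0 ->
      (forall i, i < m -> exists y, recf_eval f (i :: xs) y.+1) ->
      recf_eval (RMu f) xs m.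

Definition recursive_set (P : nat -> Prop) : Prop :=
  exists f, forall m, (P m -> recf_eval f [:: m] 1) /\
                      (~ P m -> recf_eval f [:: m] 0).

(* The joined trees together with delta are given by [extended], which consists
   of the premises with some additional discharges. *)
Record inference := Inference {
  premises : seq tree;
  conclusion : form;
  extended : seq tree }.

Definition associated (i : inference) : tree :=
  Nd (conclusion i) None (extended i).

Fixpoint extends_discharge (t u : tree) : bool :=
  match t, u with
  | As A j, As B k => (A == B) && ((j == None) || (j == k))
  | Nd A j ts, Nd B k us =>
      [&& A == B, (j == None) || (j == k) & all2 extends_discharge ts us]
  | _, _ => false
  end.

Definition is_inference (i : inference) : Prop :=
  [/\ all structure (premises i), structure (associated i)
    & all2 extends_discharge (premises i) (extended i)].

Fixpoint code_tree (t : tree) : nat :=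
  match t with
  | As A j => CodeSeq.code [:: 0; choice.pickle A; choice.pickle j]
  | Nd A j ts =>
      CodeSeq.code [:: 1; choice.pickle A; choice.pickle j; CodeSeq.code (map code_tree ts)]
  end.

Definition code_inference (i : inference) : nat :=
  CodeSeq.code [:: CodeSeq.code (map code_tree (premises i));
                   choice.pickle (conclusion i);
                   CodeSeq.code (map code_tree (extended i))].

Definition is_rule (R : inference -> Prop) : Prop :=
  (forall i, R i -> is_inference i) /\
  recursive_set (fun m => exists2 i, R i & code_inference i = m).

(* u is t with some undischarged assumptions X discharged at the d-th node below
   the root of t *)
Fixpoint discharges (X : form) (d : nat) (t u : tree) : bool :=
  match t, u with
  | As A j, As B k =>
      (A == B) && ((k == j) || [&& A == X, j == None & k == Some d])
  | Nd A j ts, Nd B k us =>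
      [&& A == B, j == k & all2 (discharges X d.+1) ts us]
  | _, _ => false
  end.

Inductive introduction : inference -> Prop :=
  | IntroAnd D1 D2 :
      introduction (Inference [:: D1; D2] (And (lab D1) (lab D2)) [:: D1; D2])
  | IntroOr1 D1 Y : introduction (Inference [:: D1] (Or (lab D1) Y) [:: D1])
  | IntroOr2 D1 X : introduction (Inference [:: D1] (Or X (lab D1)) [:: D1])
  | IntroImp X D1 D1' :
      discharges X 0 D1 D1' ->
      introduction (Inference [:: D1] (Imp X (lab D1)) [:: D1']).

Definition canonical (D : tree) : Prop :=
  exists i, [/\ is_inference i, introduction i & D = associated i].

(** * Reductions *)

Definition pmap_tree := tree -> option tree.

Definition reduction_for (R : inference -> Prop) (phi : pmap_tree) : Prop :=
  forall D E, phi D = Some E ->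
    [/\ exists2 i, R i & D = associated i,
        structure E /\ lab E = lab D,
        undischarged E `<=` undischarged D
      & forall sigma, assignment sigma (undischarged D) ->
          phi (subst sigma D) = Some (subst sigma E)].

Definition reduction (phi : pmap_tree) : Prop :=
  exists2 R, is_rule R & reduction_for R phi.

Definition reductions := pmap_tree -> Prop.

Definition set_of_reductions (J : reductions) : Prop :=
  forall phi, J phi -> reduction phi.

Definition lift (d : nat) (j : option nat) : option nat :=
  if j is Some e then Some (d + e) else None.

(* Let D0 be a subtree of a structure, to be replaced by a structure E. In the
   replacing tree E', every undischarged assumption of E is a copy of an
   assumption of D0 with the same formula which is not discharged within D0, and
   is discharged where that one was, if anywhere; a rule application may be a
   copy of one of D0 with the same premises and conclusion, and is then
   discharged where that one was. A reduction does not record which occurrence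
   is copied, so every choice is admitted. *)
Fixpoint redischarged (D0 : tree) (d : nat) (E E' : tree) : Prop :=
  match E, E' with
  | As A j, As B k =>
      A = B /\
      (if j is Some _ then k = j
       else exists2 s, (A, s) \in outer_as 0 D0 & k = lift d s)
  | Nd A j ts, Nd B k us =>
      [/\ A = B,
          k = j \/
          j = None /\
          (exists2 e, ((A, map lab ts), e) \in outer_rules 0 D0
                    & k = Some (d + e))
        & (fix all_children (ts us : seq tree) : Prop :=
             match ts, us with
             | [::], [::] => True
             | t :: ts', u :: us' =>
                 redischarged D0 d.+1 t u /\ all_children ts' us'
             | _, _ => False
             end) ts us]
  | _, _ => False
  end.

Inductive replaced (S : tree -> tree -> Prop) : tree -> tree -> Prop :=
  | ReplacedRoot D0 E' : S D0 E' -> replaced S D0 E'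
  | ReplacedAbove A j us vs t t' :
      replaced S t t' ->
      replaced S (Nd A j (us ++ t :: vs)) (Nd A j (us ++ t' :: vs)).

Definition contraction (J : reductions) (D0 E' : tree) : Prop :=
  exists phi E, [/\ J phi, phi (cut 0 D0) = Some E & redischarged D0 0 E E'].

Definition step (J : reductions) (D D' : tree) : Prop :=
  replaced (contraction J) D D' /\ structure D'.

Definition reduces (J : reductions) : tree -> tree -> Prop :=
  Relation_Operators.clos_refl_trans tree (step J).

(** * Validity of arguments *)

(* Validity on a base of <D, J>, for D not necessarily closed, relative to
   validity [V A] for closed structures with conclusion A. *)
Definition valid_from (n : nat)
    (V : form -> rules -> reductions -> tree -> Prop)
    (B : rules) (J : reductions) (D : tree) : Prop :=
  if closed D then V (lab D) B J D
  else forall sigma (J' : reductions) C,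
    closed_assignment sigma (undischarged D) ->
    set_of_reductions J' -> (forall phi, J phi -> J' phi) ->
    extends_base n B C ->
    (forall A, A \in undischarged D -> V A C J' (sigma A)) ->
    V (lab D) C J' (subst sigma D).

(* Closed structures with conclusion A, by recursion on A. The conclusions and
   undischarged assumptions of the immediate sub-structures of a closed canonical
   structure are immediate subformulas of A (lemma [immediate_canonical]), so the
   default value is not used; [validE] below is the resulting clause-by-clause
   characterization of validity. *)
Fixpoint closed_valid (n : nat) (A : form) (B : rules) (J : reductions)
    (D : tree) : Prop :=
  match A with
  | Atm _ => exists2 D', reduces J D D' & closed_derivation B D'
  | And X Y | Or X Y | Imp X Y =>
      exists D', [/\ reduces J D D', canonical D' &
        forall D1, List.In D1 (immediate D') ->
          valid_from n (fun F => if F == X then closed_valid n X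
                                 else if F == Y then closed_valid n Y
                                 else fun _ _ _ => False) B J D1]
  end.

Definition valid (n : nat) : rules -> reductions -> tree -> Prop :=
  valid_from n (closed_valid n).

Definition a_consequence (n : nat) (B : rules) (G : {fset form}) (A : form) :
    Prop :=
  exists D J, [/\ from_to G A D, set_of_reductions J & valid n B J D].

Lemma tree_nested_ind (P : tree -> Prop) :
  (forall A j, P (As A j)) ->
  (forall A j ts, (forall t, List.In t ts -> P t) -> P (Nd A j ts)) ->
  forall t, P t.
Proof.
move=> HA HN; fix IH 1; case=> [A j|A j ts]; first exact: HA.
apply: HN; elim: ts => [|t ts IHts] u /=; first by case.
by case=> [<-|/IHts]; first exact: IH.
Qed.

Lemma in_flatten_map (T : Type) (S : eqType) (f : T -> seq S) x ts :
  x \in flatten (map f ts) <-> exists2 t, List.In t ts & x \in f t.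
Proof.
elim: ts => [|t ts IH] /=; first by split=> [|[]].
rewrite mem_cat; split.
  by case/orP => [?|/IH[u ? ?]]; [exists t => //; left|exists u => //; right].
by case=> u [<- ->|hu xu] //; apply/orP; right; apply/IH; exists u.
Qed.

Lemma all_In (T : Type) (p : pred T) ts t : all p ts -> List.In t ts -> p t.
Proof. by elim: ts => //= u ts IH /andP[pu pts] [<-|/(IH pts)]. Qed.

Lemma undischargedP A D :
  reflect (exists s, (A, s) \in outer_as 0 D) (A \in undischarged D).
Proof.
rewrite inE /=; apply: (iffP mapP) => [[[B s] h ->]|[s h]]; first by exists s.
by exists (A, s).
Qed.

Lemma outer_as_shift A s d m t :
  (A, s) \in outer_as (m + d) t <->
  if s is Some e then (A, Some (e + d)) \in outer_as m t
  else (A, None) \in outer_as m t.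
Proof.
elim/tree_nested_ind: t m => [B [k|]|B j ts IH] m /=.
- case: (ltnP k m) => [lkm|lmk].
    by rewrite (leq_trans lkm (leq_addr _ _)) in_nil; case: s.
  case: ltnP => [l|l]; case: s => [e|];
    rewrite ?in_nil ?inE /= !xpair_eqE ?andbF //; split=> //.
  + by case/andP=> _ /eqP[E]; rewrite -ltn_subLR // -E ltnNge leq_addl in l.
  + case/andP=> /eqP-> /eqP[->]; apply/andP; split=> //.
    by apply/eqP; congr Some; rewrite subnDA subnK // leq_subRL.
  + case/andP=> /eqP-> /eqP[E]; apply/andP; split=> //.
    by apply/eqP; congr Some; rewrite subnDA -E addnK.
- by case: s => [e|] //; rewrite !inE !xpair_eqE !andbF.
- case: s IH => [e|] IH; split=> /in_flatten_map[t ht h];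
  apply/in_flatten_map; exists t => //.
  + by apply/(IH t ht m.+1); rewrite addSn.
  + by rewrite -addSn; apply/(IH t ht m.+1).
  + by apply/(IH t ht m.+1); rewrite addSn.
  + by rewrite -addSn; apply/(IH t ht m.+1).
Qed.

Lemma outer_as_wf A e d t : wf d t -> (A, Some e) \notin outer_as d t.
Proof.
elim/tree_nested_ind: t d => [B [k|]|B j ts IH] d /=.
- by move=> ->.
- by rewrite inE xpair_eqE andbF.
case/and3P=> _ _ hall; apply/negP => /in_flatten_map[t ht].
by apply/negP/IH => //; apply: all_In ht.
Qed.

Lemma lab_cut d t : lab (cut d t) = lab t.
Proof. by case: t. Qed.

Lemma outer_as_cut A d t :
  (exists s, (A, s) \in outer_as d (cut d t)) <->
  (exists s, (A, s) \in outer_as d t).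
Proof.
elim/tree_nested_ind: t d => [B [k|]|B j ts IH] d /=.
- case: (ltnP k d) => /= lk; first by rewrite lk.
  by split=> -[s]; rewrite inE xpair_eqE => /andP[/eqP-> _];
    [exists (Some (k - d))|exists None]; rewrite inE eqxx.
- by [].
split=> -[s] /in_flatten_map[t].
  rewrite List.in_map_iff => -[u [<- hu]] h.
  have [s' h'] := (IH u hu d.+1).1 (ex_intro _ s h).
  by exists s'; apply/in_flatten_map; exists u.
move=> ht h; have [s' h'] := (IH t ht d.+1).2 (ex_intro _ s h).
exists s'; apply/in_flatten_map; exists (cut d.+1 t) => //.
by rewrite List.in_map_iff; exists t.
Qed.

Lemma undischarged_cut t : undischarged (cut 0 t) = undischarged t.
Proof.
apply/fsetP => A; apply/undischargedP/undischargedP; first by move/outer_as_cut.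
by move=> h; apply/outer_as_cut.
Qed.

Lemma lab_redischarged D0 d E E' : redischarged D0 d E E' -> lab E' = lab E.
Proof. by case: E E' => [A j|A j ts] [B k|B k us] //= -[]. Qed.

Lemma outer_as_redischarged D0 d E E' A s : wf d E -> redischarged D0 d E E' ->
  (A, s) \in outer_as d E' -> (A, s) \in outer_as 0 D0.
Proof.
elim/tree_nested_ind: E d E' => [B j|B j ts IH] d [B' k|B' k us] //=.
  case: j => [j|] /=; first by move=> ld [_ ->]; rewrite ld.
  move=> _ [<- [[e|] hs ->]] /=; last by rewrite inE => /eqP->.
  by rewrite ltnNge leq_addr /= addKn inE => /eqP->.
case/and3P=> _ _ hwf [_ _ hch] /in_flatten_map[u hu h].
elim: ts us IH hwf hch hu => [|t ts IHts] [|v us] //= IH /andP[wt wts] [rt rts] [E|hu].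
  by subst v; apply: (IH t (or_introl erefl) d.+1 u).
by apply: (IHts us) => // t' ht'; apply: IH; right.
Qed.

Lemma step_outer_as J D D' : set_of_reductions J -> step J D D' ->
  lab D' = lab D /\ undischarged D' `<=` undischarged D.
Proof.
move=> HJ [hr _].
suff [-> h] : lab D' = lab D /\
    forall A s, (A, s) \in outer_as 0 D' -> (A, s) \in outer_as 0 D.
  split=> //; apply/fsubsetP => A /undischargedP[s hs].
  by apply/undischargedP; exists s; apply: h.
elim: hr => [D0 E' [phi [E [Jphi hE hred]]]|A j us vs t t' _ [elab IH]].
  have [R _ hR] := HJ _ Jphi; have [_ [wE lE] _ _] := hR _ _ hE.
  split; first by rewrite (lab_redischarged hred) lE lab_cut.
  by move=> A s; apply: outer_as_redischarged wE hred.
split=> // B s; rewrite /= !map_cat /= !flatten_cat /= !mem_cat.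
case/or3P=> [->|h|->]; rewrite ?orbT //.
suff -> : (B, s) \in outer_as 1 t by rewrite orbT.
by apply/(outer_as_shift B s 1 0); case: s h => [e|] /(outer_as_shift B _ 1 0) /IH.
Qed.

Lemma reducesP J D D' : set_of_reductions J -> reduces J D D' ->
  lab D' = lab D /\ undischarged D' `<=` undischarged D.
Proof.
move=> HJ; elim=> [x y /(step_outer_as HJ) //|x|x y z _ [e1 s1] _ [e2 s2]] //.
by split; [rewrite e2|apply: fsubset_trans s2 s1].
Qed.

Lemma outer_as_discharges X A e d D t : wf d D -> discharges X d D t ->
  (A, Some e) \in outer_as d t -> A = X.
Proof.
elim/tree_nested_ind: D d t => [B j|B j ts IH] d [B' k|B' k us] //=.
  move=> wj /andP[/eqP-> /orP[/eqP->|/and3P[/eqP-> _ /eqP->]]].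
    by case: j wj => [j|] /=; [move->|rewrite inE xpair_eqE andbF].
  by rewrite ltnn inE xpair_eqE => /andP[/eqP].
case/and3P=> _ _ hwf /and3P[_ _ hch] /in_flatten_map[u hu h].
elim: ts us IH hwf hch hu => [|t ts IHts] [|v us] //= IH /andP[wt wts] /andP[rt rts] [E|hu].
  by subst v; apply: (IH t (or_introl erefl) d.+1 u).
by apply: (IHts us) => // t' ht'; apply: IH; right.
Qed.

Lemma lab_discharges X d D t : discharges X d D t -> lab t = lab D.
Proof. by case: D t => [A j|A j ts] [B k|B k us] //= /andP[/eqP->]. Qed.

Definition is_immediate_subformula (F A : form) : bool :=
  match A with
  | Atm _ => false
  | And X Y | Or X Y | Imp X Y => (F == X) || (F == Y)
  end.

Lemma immediate_canonical D D1 : canonical D -> closed D ->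
  List.In D1 (immediate D) ->
  is_immediate_subformula (lab D1) (lab D) /\
  forall F, F \in undischarged D1 -> is_immediate_subformula F (lab D).
Proof.
case=> i [[hp ha _] hi ->] /eqP hc; rewrite /immediate /=.
rewrite List.in_map_iff => -[t [<- ht]]; rewrite lab_cut undischarged_cut.
have h0 F s : (F, s) \in outer_as 0 t -> s = Some 0.
  case: s => [[|e]|] // h; exfalso; suff : F \in undischarged (associated i).
  - by rewrite hc.
  - apply/undischargedP; exists (Some e); apply/in_flatten_map; exists t => //.
    by apply/(outer_as_shift F (Some e) 1 0); rewrite addn1.
  - by rewrite hc.
  apply/undischargedP; exists None; apply/in_flatten_map; exists t => //.
  by apply/(outer_as_shift F None 1 0).
have wf0 F : wf 0 t -> F \in undischarged t -> false.
  move=> w /undischargedP[s hs]; have e := h0 _ _ hs; subst s.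
  by rewrite (negbTE (outer_as_wf F 0 w)) in hs.
case: hi hp ht {ha hc} => [D2 D3|D2 Y|D2 X|X D2 D2' hd] /=.
- case/and3P=> w2 w3 _ [E|[E|//]]; subst t; rewrite eqxx ?orbT; split=> // F.
    by move/(wf0 F w2).
  by move/(wf0 F w3).
- by case/andP=> w2 _ [E|//]; subst t; rewrite eqxx; split=> // F /(wf0 F w2).
- by case/andP=> w2 _ [E|//]; subst t; rewrite eqxx orbT; split=> // F /(wf0 F w2).
case/andP=> w2 _ [E|//]; subst t; rewrite (lab_discharges hd) eqxx orbT; split=> //.
move=> F /undischargedP[s hs]; have e := h0 _ _ hs; subst s.
by rewrite (outer_as_discharges w2 hd hs) eqxx.
Qed.

Lemma undischarged_subst sigma D :
  closed_assignment sigma (undischarged D) -> structure D -> closed (subst sigma D).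
Proof.
case=> ha hc wD; apply/eqP/fsetP => A; rewrite in_fset0; apply/negP => /undischargedP[s].
have key F B r : F \in undischarged D -> (B, r) \in outer_as 0 (sigma F) -> false.
  move=> hF h; move/hc/eqP/fsetP/(_ B): hF; rewrite in_fset0 => <-.
  by apply/undischargedP; exists r.
have {key} : forall F, (F, None) \in outer_as 0 D ->
    wf 0 (sigma F) /\ forall B r, (B, r) \in outer_as 0 (sigma F) -> false.
  move=> F h; have hF : F \in undischarged D by apply/undischargedP; exists None.
  by split; [case: (ha F hF)|move=> B r; apply: key].
rewrite /structure in wD; move: {ha hc} wD; move: {1 2 5}0 => d.
elim/tree_nested_ind: D d => [B [k|]|B j ts IH] d /=.
- by move->.
- move=> _ /(_ B); rewrite inE eqxx => /(_ isT) [_ h] h'.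
  move/(outer_as_shift A s d 0): h'.
  by case: s => [e|] /h.
case/and3P=> _ _ hwf hts /in_flatten_map[u]; rewrite List.in_map_iff => -[t [<- ht]].
apply: (IH t ht d.+1 (all_In hwf ht)) => F hF; apply: hts.
by apply/in_flatten_map; exists t.
Qed.

Lemma lab_subst sigma D :
  structure D -> assignment sigma (undischarged D) -> lab (subst sigma D) = lab D.
Proof.
case: D => [A [k|]|A j ts] //= _ /(_ A).
by case=> //; apply/undischargedP; exists None; rewrite inE.
Qed.

Lemma validE n B J D : structure D -> set_of_reductions J ->
  valid n B J D <->
  if closed D then
    if is_atom (lab D) then exists2 D', reduces J D D' & closed_derivation B D'
    else exists D', [/\ reduces J D D', canonical D'
                      & forall D1, List.In D1 (immediate D') -> valid n B J D1]
  else forall sigma (J' : reductions) C,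
    closed_assignment sigma (undischarged D) ->
    set_of_reductions J' -> (forall phi, J phi -> J' phi) ->
    extends_base n B C ->
    (forall A, A \in undischarged D -> valid n C J' (sigma A)) ->
    valid n C J' (subst sigma D).
Proof.
move=> wD HJ; rewrite {1}/valid /valid_from; case: (boolP (closed D)) => cD.
  have key (V : form -> rules -> reductions -> tree -> Prop) :
      (forall F, is_immediate_subformula F (lab D) -> V F = closed_valid n F) ->
      (exists D', [/\ reduces J D D', canonical D'
         & forall D1, List.In D1 (immediate D') -> valid_from n V B J D1]) <->
      (exists D', [/\ reduces J D D', canonical D'
         & forall D1, List.In D1 (immediate D') -> valid n B J D1]).
    move=> hV; suff hE D' D1 : reduces J D D' -> canonical D' ->
        List.In D1 (immediate D') -> valid_from n V B J D1 <-> valid n B J D1.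
      by split=> -[D' [hr hc hi]]; exists D'; split=> // D1 h;
        apply/(hE D' D1 hr hc h); apply: hi.
    move=> hr hc h; have [el su] := reducesP HJ hr.
    have cD' : closed D' by rewrite /closed -fsubset0 -(eqP cD).
    have [] := immediate_canonical hc cD' h; rewrite el => hl hu.
    rewrite /valid /valid_from (hV _ hl); case: ifP => // _.
    split=> H sigma J' C h1 h2 h3 h4 h5; apply: H => // A hA.
      by rewrite (hV _ (hu _ hA)); apply: h5.
    by rewrite -(hV _ (hu _ hA)); apply: h5.
  case E : (lab D) key => [a|X Y|X Y|X Y] key //=; apply: key => F /=;
  by case: eqP => [->|_] //=; case: eqP => [->|].
split=> H sigma J' C h1 h2 h3 h4 h5.
  rewrite /valid /valid_from (undischarged_subst h1 wD) (lab_subst wD h1.1).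
  apply: H => // A hA; move: (h5 A hA).
  by rewrite /valid /valid_from (h1.2 _ hA) (h1.1 _ hA).2.
move: (H sigma J' C h1 h2 h3 h4).
rewrite /valid /valid_from (undischarged_subst h1 wD) (lab_subst wD h1.1).
by apply=> A hA; rewrite (h1.2 _ hA) (h1.1 _ hA).2; apply: h5.
Qed.

(* Main.v *)
From Stdlib Require List Relation_Operators.
From mathcomp Require Import all_boot finmap.
Require Import Defs.

(** The heart of the matter is that a closed argument which is valid on an
    extension C of B has a conclusion A with [s_valid n C A]
    ([closed_argument_s_valid], by induction on A).  A valid closed argument
    reduces to a closed derivation in C or to a canonical structure with valid
    immediate sub-structures; atoms, conjunctions and disjunctions follow at
    once, the last because [s_valid] persists under extension of the base.

    For an implication X -> Y, the immediate sub-structure D1 concludes Y and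
    leaves at most X undischarged, so validity of D1 has to be turned into
    consequence from X to Y.  Here the assumed implication from [s_valid] to
    reducibility is needed, on every extension E of C: if X is [s_valid] on E,
    then it has a valid closed argument on E, which may be plugged into D1, and
    the induction hypothesis for Y applies to the resulting closed argument.
    The same transfer ([open_argument_transfer]) applied to an arbitrary valid
    argument gives the theorem.

    The arguments plugged in come with different sets of reductions.  As validity
    persists when reductions are added ([closed_validS]), all of these sets may be
    enlarged to the set of all reductions. *)

Set Implicit Arguments.
Unset Strict Implicit.
Unset Printing Implicit Defensive.

Local Open Scope fset_scope.

(** * Persistence under extension of the base *)

Lemma extends_base_refl n B C : extends_base n B C -> extends_base n C C.
Proof. by case. Qed.

Lemma extends_base_trans n B C E :
  extends_base n B C -> extends_base n C E -> extends_base n B E.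
Proof. by case=> sBC _ [sCE hE]; split=> // r /sBC /sCE. Qed.

Scheme derivation_mutind := Induction for derivation Sort Prop
  with premise_derivations_mutind := Induction for premise_derivations Sort Prop.

Lemma derivationS (B C H : rules) ctx t : (forall r, B r -> C r) ->
  derivation B H ctx t -> derivation C H ctx t.
Proof.
move=> sBC.
apply: (@derivation_mutind B H (fun c t _ => derivation C H c t)
  (fun c ps ts _ => premise_derivations C H c ps ts))
  => {ctx t} [ctx ps a j ts av _ ih|ctx|ctx p ps t ts lt _ iht _ ihts].
- apply: Derivation ih; case: j av => [k|] //= [/sBC|] ?; by [left|right].
- exact: PremisesNil.
- exact: PremisesCons.
Qed.

Lemma derivableS (B C : rules) a :
  (forall r, B r -> C r) -> derivable B a -> derivable C a.
Proof. by move=> sBC [D dD lD]; exists D => //; apply: derivationS dD. Qed.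

Lemma s_validS n B C A : extends_base n B C -> s_valid n B A -> s_valid n C A.
Proof.
elim: A B C => [a|X IHX Y IHY|X _ Y _|X _ Y _] B C hBC /=.
- by apply: derivableS; case: hBC.
- by case=> /(IHX _ _ hBC) ? /(IHY _ _ hBC).
- by move=> h E /(extends_base_trans hBC); apply: h.
- by move=> h E /(extends_base_trans hBC); apply: h.
Qed.

(** * Persistence under addition of reductions *)

Lemma reducesS (J J' : reductions) D E : (forall phi, J phi -> J' phi) ->
  reduces J D E -> reduces J' D E.
Proof.
move=> sJ; elim=> [x y [hr wy]|x|x y z _ h1 _ h2].
- apply: Relation_Operators.rt_step; split=> //; elim: hr.
    move=> D0 E' [phi [F [Jphi hF hred]]]; apply: ReplacedRoot.
    by exists phi, F; split=> //; apply: sJ.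
  by move=> A j us vs t t' _; apply: ReplacedAbove.
- exact: Relation_Operators.rt_refl.
- exact: Relation_Operators.rt_trans h1 h2.
Qed.

Lemma valid_fromS n (V : form -> rules -> reductions -> tree -> Prop) B
    (J J' : reductions) D :
  (forall D', V (lab D) B J D' -> V (lab D) B J' D') ->
  (forall phi, J phi -> J' phi) ->
  valid_from n V B J D -> valid_from n V B J' D.
Proof.
move=> hV sJ; rewrite /valid_from; case: ifP => _; first exact: hV.
by move=> h sigma K C h1 h2 h3; apply: h => // phi /sJ; apply: h3.
Qed.

Lemma closed_validS n A B (J J' : reductions) D :
  (forall phi, J phi -> J' phi) ->
  closed_valid n A B J D -> closed_valid n A B J' D.
Proof.
move=> sJ; elim: A D => [a|X IHX Y IHY|X IHX Y IHY|X IHX Y IHY] D /=;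
  first by case=> D' hr hd; exists D' => //; apply: reducesS hr.
all: case=> D' [hr hc hi]; exists D'; split=> //; first exact: reducesS hr.
all: move=> D1 /hi; apply: valid_fromS => // D2.
all: by case: ifP => _; [apply: IHX|case: ifP => // _; apply: IHY].
Qed.

(** Validity of D looks up closed validity only at the conclusion and at the
    undischarged assumptions of D; this identifies the case distinction on
    immediate subformulas in [closed_valid] with [closed_valid] itself. *)
Lemma valid_from_ext n (V W : form -> rules -> reductions -> tree -> Prop) B J D :
  (forall F, F = lab D \/ F \in undischarged D -> V F = W F) ->
  valid_from n V B J D -> valid_from n W B J D.
Proof.
move=> eVW; rewrite /valid_from (eVW (lab D)); last by left.
case: ifP => // _ h sigma J' C h1 h2 h3 h4 h5; apply: h => // A hA.
by rewrite eVW; [apply: h5|right].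
Qed.

(** * Immediate sub-structures *)

Lemma has_cut (p : pred tree) d ts :
  (forall t, List.In t ts -> p (cut d t) -> p t) ->
  has p (map (cut d) ts) -> has p ts.
Proof.
elim: ts => //= t ts IH h /orP[/(h t (or_introl erefl)) ->|hts] //.
by apply/orP; right; apply: IH => // u hu; apply: h; right.
Qed.

Lemma f_hits_cut k d t : f_hits k (cut d t) -> f_hits k t.
Proof.
elim/tree_nested_ind: t k d => [A j|A j ts IH] k d /=; first by case: ifP.
by apply: has_cut => t /IH; apply.
Qed.

Lemma hg_hits_cut k d t : hg_hits k (cut d t) -> hg_hits k t.
Proof.
elim/tree_nested_ind: t k d => [A j|A j ts IH] k d //= /orP[|h].
  by case: ifP => // _ ->.
by apply/orP; right; apply: has_cut h => t /IH; apply.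
Qed.

(** Truncation restores well-formedness at any depth: it only removes discharges,
    hence only removes constraints on nodes. *)
Lemma wf_cut d e t : wf e t -> wf d (cut d t).
Proof.
elim/tree_nested_ind: t d e => [A j|A j ts IH] d e /=.
  by move=> _; case: ifP.
case/and3P=> _ hat hts; apply/and3P; split; first by case: ifP.
  apply/implyP => h.
  have /(implyP hat)/and3P[aA ats nf] : (j != None) || has (hg_hits 0) ts.
    case/orP: h => [|h]; first by case: ifP => // _ ->.
    by apply/orP; right; apply: has_cut h => t _; apply: hg_hits_cut.
  apply/and3P; split=> //.
    by rewrite all_map; apply: sub_all ats => t; rewrite /= lab_cut.
  by apply: contra nf; apply: has_cut => t _; apply: f_hits_cut.
elim: ts IH hts {hat} => //= t ts IHts IH /andP[wt wts]; apply/andP; split.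
  by apply: IH wt; left.
by apply: IHts => // u hu; apply: IH; right.
Qed.

Lemma structure_immediate D D1 :
  structure D -> List.In D1 (immediate D) -> structure D1.
Proof.
case: D => [A j|A j ts] //= /and3P[_ _ hts] /List.in_map_iff[t [<- ht]].
exact: wf_cut (all_In hts ht).
Qed.

(** In a closed structure, an assumption undischarged in an immediate
    sub-structure is discharged below that sub-structure. *)
Lemma undischarged_immediate A j ts t F : closed (Nd A j ts) ->
  List.In t ts -> F \in undischarged (cut 0 t) ->
  exists e, (F, Some e) \in outer_as 0 t.
Proof.
move=> /eqP hc ht; rewrite undischarged_cut => /undischargedP[[e|] h].
  by exists e.
suff : F \in undischarged (Nd A j ts) by rewrite hc.
apply/undischargedP; exists None; apply/in_flatten_map; exists t => //.
by apply/(outer_as_shift F None 1 0).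
Qed.

Lemma closed_immediate A j ts t : closed (Nd A j ts) ->
  List.In t ts -> structure t -> closed (cut 0 t).
Proof.
move=> hc ht wt; apply/eqP/fsetP => F; rewrite in_fset0; apply/negP => hF.
have [e he] := undischarged_immediate hc ht hF.
by rewrite (negbTE (outer_as_wf F e wt)) in he.
Qed.

(** The shape of a closed canonical structure. Only an introduction of an
    implication X -> Y may leave an assumption of its premise open, namely X. *)
Lemma canonical_closed_shape D : canonical D -> closed D ->
  match lab D with
  | Atm _ => False
  | And X Y => exists D1 D2,
      [/\ immediate D = [:: D1; D2], closed D1, closed D2,
          lab D1 = X & lab D2 = Y]
  | Or X Y => exists D1,
      [/\ immediate D = [:: D1], closed D1 & lab D1 = X \/ lab D1 = Y]
  | Imp X Y => exists D1,
      [/\ immediate D = [:: D1], undischarged D1 `<=` [fset X] & lab D1 = Y]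
  end.
Proof.
case=> i [[hp _ _] hi ->]; rewrite /associated /=.
case: hi hp => [D1 D2|D1 Y|D1 X|X D1 D1' hd] /= /andP[w1 w2] hc.
- have {w2} /andP[w2 _] := w2.
  exists (cut 0 D1), (cut 0 D2); rewrite !lab_cut; split=> //.
    by apply: closed_immediate hc _ w1; left.
  by apply: closed_immediate hc _ w2; right; left.
- exists (cut 0 D1); rewrite lab_cut; split=> //; last by left.
  by apply: closed_immediate hc _ w1; left.
- exists (cut 0 D1); rewrite lab_cut; split=> //; last by right.
  by apply: closed_immediate hc _ w1; left.
exists (cut 0 D1'); rewrite lab_cut (lab_discharges hd); split=> //.
apply/fsubsetP => F hF; rewrite in_fset1.
have [e he] := undischarged_immediate hc (or_introl erefl) hF.
by rewrite (outer_as_discharges w1 hd he).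
Qed.

(** * From valid arguments to [s_valid] *)

Lemma seq_choice (T : eqType) (U : Type) (u0 : U) (P : T -> U -> Prop)
    (s : seq T) :
  (forall x, x \in s -> exists u, P x u) ->
  exists f : T -> U, forall x, x \in s -> P x (f x).
Proof.
elim: s => [|x s IH] h; first by exists (fun=> u0).
have [f hf] : exists f : T -> U, forall y, y \in s -> P y (f y).
  by apply: IH => y ys; apply: h; rewrite inE ys orbT.
have [u hu] := h x (mem_head _ _).
exists (fun y => if y == x then u else f y) => y.
by rewrite inE; case: eqP => [->|_] //= /hf.
Qed.

(** If validity of closed arguments for the conclusion of D implies [s_valid] on
    all extensions of B, then validity of D, possibly open, makes its conclusion
    follow from its undischarged assumptions in the sense of [s_valid]. *)
Lemma open_argument_transfer n B :
  (forall (G : {fset form}) A C,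
     extends_base n B C -> s_consequence n C G A -> a_consequence n C G A) ->
  forall C E J D,
  (forall C' J' D', extends_base n B C' -> set_of_reductions J' ->
     closed D' -> lab D' = lab D -> closed_valid n (lab D) C' J' D' ->
     s_valid n C' (lab D)) ->
  extends_base n B C -> extends_base n C E -> set_of_reductions J ->
  structure D -> valid n C J D ->
  (forall X, X \in undischarged D -> s_valid n E X) -> s_valid n E (lab D).
Proof.
move=> hsa C E J D hcl hBC hCE hJ wD; rewrite /valid /valid_from.
have hBE := extends_base_trans hBC hCE.
case: (boolP (closed D)) => cD vD hs.
  by apply: (s_validS hCE); apply: hcl vD.
(* Each assumption is [s_valid] on E, so it has a valid closed argument there;
   the set of all reductions serves all of these arguments, and D, at once. *)
have [sigma hsig] : exists sigma : form -> tree, forall X,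
    X \in undischarged D -> [/\ structure (sigma X), closed (sigma X),
      lab (sigma X) = X & closed_valid n X E reduction (sigma X)].
  apply: (@seq_choice _ _ (As (Atm Bot) None) (fun X t =>
    [/\ structure t, closed t, lab t = X & closed_valid n X E reduction t])
    (undischarged D)) => X /hs sX.
  have [|D2 [J2 [[w2 u2 l2] hJ2 v2]]] := hsa fset0 X E hBE.
    by rewrite /s_consequence eqxx.
  have c2 : closed D2 by rewrite /closed u2.
  exists D2; split=> //; apply: (closed_validS hJ2).
  by move: v2; rewrite /valid /valid_from c2 l2.
have ha : closed_assignment sigma (undischarged D).
  by split=> X /hsig[].
apply: (hcl E reduction (subst sigma D)) => //.
- exact: undischarged_subst.
- by apply: lab_subst => //; case: ha.
- by apply: vD => // X /hsig[].
Qed.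

Lemma closed_argument_s_valid n B :
  (forall (G : {fset form}) A C,
     extends_base n B C -> s_consequence n C G A -> a_consequence n C G A) ->
  forall A C J D, extends_base n B C -> set_of_reductions J ->
  closed D -> lab D = A -> closed_valid n A C J D -> s_valid n C A.
Proof.
move=> hsa; elim=> [a|X IHX Y IHY|X IHX Y IHY|X IHX Y IHY] C J D hBC hJ cD lD /=.
  by case=> D' hr hd; exists D' => //; rewrite (reducesP hJ hr).1.
all: case=> D' [hr hc hi]; have [el su] := reducesP hJ hr.
all: have cD' : closed D' by rewrite /closed -fsubset0 -(eqP cD).
all: have := canonical_closed_shape hc cD'; rewrite el lD.
- case=> D1 [D2 [ei c1 c2 l1 l2]]; rewrite ei in hi.
  have := hi D1 (or_introl erefl); have := hi D2 (or_intror (or_introl erefl)).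
  rewrite /valid_from c1 c2 l1 l2 !eqxx => v2 v1; split; first exact: IHX v1.
  (* X and Y may be the same formula, and then the lookup at Y stops at X. *)
  case: eqP v2 => [eYX|_] v2; last exact: IHY v2.
  by rewrite eYX; apply: IHX v2 => //; rewrite l2.
- case=> D1 [ei c1 l1]; rewrite ei in hi.
  have := hi D1 (or_introl erefl); rewrite /valid_from c1 => v1.
  suff h : s_valid n C X \/ s_valid n C Y.
    move=> E hCE a hX hY; have hE := extends_base_refl hCE.
    by case: h => /(s_validS hCE); [apply: hX|apply: hY].
  move: v1; case: eqP => [e|_]; first by left; apply: IHX e v1.
  case: eqP => [e v1|//]; by right; apply: IHY e v1.
case=> D1 [ei u1 l1]; have h1 : List.In D1 (immediate D') by rewrite ei; left.
have w1 : structure D1.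
  by apply: structure_immediate h1; case: hc => i [[_ wi _] _ ->].
have v1 : valid n C J D1.
  apply: valid_from_ext (hi D1 h1) => F hF.
  case: eqP => [->|nX] //; case: eqP => [->|nY] //; case: hF => [|hF].
    by rewrite l1.
  by move/fsubsetP/(_ F hF): u1; rewrite in_fset1 => /eqP.
move=> E hCE sX; rewrite -l1.
apply: (open_argument_transfer hsa) v1 _ => //; first by rewrite l1.
by move=> F /(fsubsetP u1); rewrite in_fset1 => /eqP->.
Qed.

Theorem theorem4 (n : nat) (B : rules) (hB : base_of_level n B)
  (hsa : forall (G : {fset form}) (A : form) (C : rules),
     extends_base n B C -> s_consequence n C G A -> a_consequence n C G A) :
  forall (G : {fset form}) (A : form) (C : rules),
    extends_base n B C -> a_consequence n C G A -> s_consequence n C G A.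
Proof.
move=> G A C hBC [D [J [[wD uD lD] hJ vD]]].
have transfer E : extends_base n C E ->
    (forall X, X \in G -> s_valid n E X) -> s_valid n E A.
  rewrite -uD -lD => hCE; apply: (open_argument_transfer hsa) vD => // C' J' D'.
  exact: (closed_argument_s_valid hsa).
rewrite /s_consequence; case: eqP => [eG|_] //.
by apply: transfer (extends_base_refl hBC) _ => X; rewrite eG.
Qed.
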